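(* Let $\ell\ge 1$ and let $a_1,\dots,a_\ell$ be positive integers. Let $T=C_{a_1,a_2,\dots,a_\ell}$ be the corresponding nondegenerate caterpillar, let $K$ be its number of vertices, and let $a=\min\{a_t : 1\le t\le \ell\}$. Then $$\text{w-sat}(T)=K-2+\binom{a-1}{2}.$$
   Context: All graphs are simple, finite and undirected. Given a graph $F$, a graph $G$ is weakly $F$-saturated if the non-edges of $G$ can be added one by one in some order, ending with the complete graph on $V(G)$, so that each newly added edge creates a new copy of $F$ (a subgraph isomorphic to $F$, not necessarily induced, containing the new edge). For an integer $n$, $\text{w-sat}(n,F)$ is the minimum number of edges of an $n$-vertex weakly $F$-saturated graph. For a tree $T$ with at least one edge, $\text{w-sat}(n,T)$ is constant for all sufficiently large $n$, and $\text{w-sat}(T)$ denotes this limit value. For positive integers $a_1,\dots,a_\ell$, the nondegenerate caterpillar $C_{a_1,\dots,a_\ell}$ is the tree formed from a path $P_\ell=(v_1,v_2,\dots,v_\ell)$ on $\ell$ vertices by adding $a_t$ pendant edges (each with a new leaf) at $v_t$, for every $t=1,\dots,\ell$. Here $\binom{m}{2}=m(m-1)/2$, so $\binom{0}{2}=\binom{1}{2}=0$. *)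

(* Defs.v *)
From HB Require Import structures.
From mathcomp Require Import all_boot.

Set Implicit Arguments.
Unset Strict Implicit.
Unset Printing Implicit Defensive.

(** A simple graph on the finite vertex type [V] is given by its edge set
    [E : {set {set V}}], a subset of the set [complete V] of all two-element
    subsets of [V]. *)

Definition complete (V : finType) : {set {set V}} :=
  [set e : {set V} | #|e| == 2].

(** [f] embeds [F] as a not necessarily induced subgraph of [E], and the
    resulting copy of [F] uses the edge [e]. *)
Definition copy_through (W V : finType) (F : {set {set W}})
    (E : {set {set V}}) (e : {set V}) (f : {ffun W -> V}) : bool :=
  [&& injectiveb f,
      [forall u in F, f @: u \in E] &
      [exists u in F, f @: u == e]].

Fixpoint saturating_order (W V : finType) (F : {set {set W}})
    (E : {set {set V}}) (s : seq {set V}) : bool :=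
  if s is e :: s' then
    [exists f : {ffun W -> V}, copy_through F (e |: E) e f]
    && saturating_order F (e |: E) s'
  else true.

(** [permutations (enum A)] lists all the orderings of the finite set [A]. *)
Definition weakly_saturated (W V : finType) (F : {set {set W}})
    (E : {set {set V}}) : bool :=
  has (saturating_order F E) (permutations (enum (complete V :\: E))).

Lemma complete_weakly_saturated (W V : finType) (F : {set {set W}}) :
  weakly_saturated F (complete V).
Proof.
apply/hasP; exists [::] => //.
by rewrite mem_permutations setDv enum_set0.
Qed.

(** The minimum ranges over a nonempty set of graphs, by
    [complete_weakly_saturated]. *)
Definition wsat (n : nat) (W : finType) (F : {set {set W}}) : nat :=
  #|[arg min_(E < complete 'I_n |
        (E \subset complete 'I_n) && weakly_saturated F E) #|E| ]|.

(** w-sat(T) = m, where w-sat(T) is the eventual value of w-sat(n, T). *)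
Definition wsat_limit (W : finType) (F : {set {set W}}) (m : nat) : Prop :=
  exists N : nat, forall n : nat, N <= n -> wsat n F = m.

(** [inl t] is the spine vertex v_t (indexed from 0), and
    [inr (Tagged _ k)] with tag [t] is the k-th leaf attached to v_t. *)
Definition caterpillar_vertex (l : nat) (a : 'I_l -> nat) : finType :=
  ('I_l + {t : 'I_l & 'I_(a t)})%type.

Definition caterpillar (l : nat) (a : 'I_l -> nat) :
    {set {set caterpillar_vertex a}} :=
  [set [set inl p.1; inl p.2] | p : 'I_l * 'I_l & p.2 == p.1.+1 :> nat]
  :|: [set [set inl (tag x); inr x] | x : {t : 'I_l & 'I_(a t)}].

Lemma caterpillar_simple (l : nat) (a : 'I_l -> nat) :
  caterpillar a \subset complete (caterpillar_vertex a).
Proof.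
apply/subsetP => e; rewrite inE => /orP[] /imsetP[].
  move=> [i j] /=; rewrite inE /= => /eqP ij ->; rewrite inE cards2.
  suff -> : (inl i != inl j :> caterpillar_vertex a) by [].
  by apply/eqP => -[] /(congr1 val) /= h; move: ij; rewrite h => /n_Sn.
by move=> x _ ->; rewrite inE cards2.
Qed.

(* Main.v *)
Require Import Defs.
From mathcomp Require Import all_boot.
From mathcomp Require Import zify.

(** Call the [l] vertices [v_1, .., v_l] of the path the spine; every edge of
    the caterpillar [T] meets the spine.  Let [K] be the number of vertices of
    [T], and let [b] be one less than the smallest number of leaves [a_t] at a
    spine vertex.  Both inequalities are proved for [n > 3 K].

    Lower bound ([caterpillar_lower_bound]).  The copy of [T] completed by the
    first added edge has a spine [S], and already the starting graph contains
    the other [K - 2] edges of that copy, all of which meet [S].  It remains to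
    find ['C(b, 2)] starting edges off [S].  Follow the process and maintain a
    set [X] such that every added edge meets [S :|: X].  Suppose that a new
    edge misses [S :|: X]; it belongs to a copy of [T], some [j > 0] spine
    vertices of which lie outside [S :|: X].  These have at least [j (b + 1)]
    leaves.  The other [l - j] spine vertices occupy part of [S :|: X], so that
    at most [#|X| + j] of those leaves fit there.  The remaining leaf edges
    avoid [S :|: X], hence all but the new one are starting edges, and adding
    the [j] spine vertices to [X] pays for them ([charged_step]).  In this
    accounting the vertices of [X], in order of arrival, contribute at least
    [b - 1, b - 2, ..] starting edges, which add up to ['C(b, 2)]: otherwise
    [X] would stay smaller than [b], and a complete graph could only be reached
    if all pairs outside [S :|: X], and hence more than enough, were edges from
    the start.

    Upper bound ([caterpillar_upper_bound]).  Start from [T] minus one leaf edge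
    at [v_t0], where [a t0 = b + 1], together with a disjoint clique on [b]
    vertices and many isolated vertices.  Swapping leaves joins [v_t0], then
    all the spine, to the isolated vertices, and then to everything off the
    spine.  A clique vertex [x] now has [b - 1] neighbours off the spine.
    It can take the place of [v_t0]: a new edge gives it one more leaf and
    [v_t0] itself gives it another, so it has [b + 1] leaves and
    becomes adjacent to everything ([outside_star]).  The whole
    clique supplies [b] neighbours to each other vertex, so these follow, and
    the edges inside the spine come last ([closed_complete]). *)

Set Implicit Arguments.
Unset Strict Implicit.
Unset Printing Implicit Defensive.

(** * Weak saturation through saturation-closed graphs *)
Section Saturation.
Variables (W V : finType) (F : {set {set W}}).
Implicit Types (E : {set {set V}}) (e : {set V}).

Definition saturation_closed E :=
  forall e f, e \in complete V -> copy_through F (e |: E) e f -> e \in E.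

(** Adding edges greedily for as long as possible ends in a saturation-closed
    graph, so no explicit order of the missing edges has to be exhibited: it is
    enough to know which edges a closed graph is forced to have. *)
Lemma weakly_saturated_closed E :
    E \subset complete V ->
    (forall E', E \subset E' -> E' \subset complete V ->
       saturation_closed E' -> complete V \subset E') ->
  weakly_saturated F E.
Proof.
move=> EC closedC.
suff [s ps so] : exists2 s, perm_eq s (enum (complete V :\: E))
                          & saturating_order F E s.
  by rewrite /weakly_saturated; apply/hasP; exists s => //; rewrite mem_permutations.
have [m] := ubnP #|complete V :\: E|.
elim: m E EC closedC => // m IH E EC closedC ltm.
have [/existsP[e /andP[De /existsP[f cf]]] | noe] :=
  boolP [exists e in complete V :\: E, exists f, copy_through F (e |: E) e f].
  have [eE eC] : e \notin E /\ e \in complete V by move: De; rewrite inE => /andP.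
  have De' : complete V :\: (e |: E) = (complete V :\: E) :\ e.
    by rewrite setDDl setUC.
  have [||| s ps so] := IH (e |: E).
  - by rewrite subUset sub1set eC.
  - by move=> E' /subUsetP[_ EE']; apply: closedC.
  - by rewrite De'; move: ltm; rewrite (cardsD1 e (_ :\: E)) De; lia.
  exists (e :: s); last by rewrite /= so andbT; apply/existsP; exists f.
  rewrite uniq_perm //.
  - rewrite /= (perm_uniq ps) enum_uniq andbT (perm_mem ps) De' mem_enum.
    by rewrite !inE eqxx.
  - exact: enum_uniq.
  - move=> x; rewrite in_cons (perm_mem ps) De' !mem_enum in_setD1.
    by case: eqP => // ->; rewrite De.
have /closedC : saturation_closed E.
  move=> e f eC cf; apply: contraR noe => eE; apply/existsP; exists e.
  by rewrite inE eE eC; apply/existsP; exists f.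
move=> /(_ (subxx _) EC); rewrite -setD_eq0 => /eqP->.
by exists [::]; rewrite ?enum_set0.
Qed.

End Saturation.

Lemma wsat_le n (W : finType) (F : {set {set W}}) (E : {set {set 'I_n}}) :
  E \subset complete 'I_n -> weakly_saturated F E -> wsat n F <= #|E|.
Proof.
rewrite /wsat => EC wE; case: arg_minnP => [|E' _]; last by apply; rewrite EC.
by rewrite subxx complete_weakly_saturated.
Qed.

Lemma wsat_ge n (W : finType) (F : {set {set W}}) m :
    (forall E : {set {set 'I_n}}, E \subset complete 'I_n ->
       weakly_saturated F E -> m <= #|E|) ->
  m <= wsat n F.
Proof.
rewrite /wsat => mE; case: arg_minnP => [|E' /andP[]]; last by move=> *; exact: mE.
by rewrite subxx complete_weakly_saturated.
Qed.

(** * Vertices and edges of a caterpillar *)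
Section Caterpillar.
Variables (l : nat) (a : 'I_l -> nat).
Notation W := (caterpillar_vertex a).
Notation leaf := {t : 'I_l & 'I_(a t)}.

(** The edge to the parent in the tree rooted at the first spine vertex.  At
    this root the truncated predecessor gives the junk value
    [[set inl 0; inl 0]], a singleton. *)
Definition parent_edge (w : W) : {set W} :=
  match w with
  | inl t => [set inl (Ordinal (leq_ltn_trans (leq_pred t) (ltn_ord t))); inl t]
  | inr x => [set inl (tag x); inr x]
  end.

Lemma inl_eqE (i j : 'I_l) : (inl i == inl j :> W) = (i == j).
Proof. by []. Qed.

Lemma inl_inrE (i : 'I_l) (x : leaf) : (inl i == inr x :> W) = false.
Proof. by []. Qed.

Lemma inr_inlE (i : 'I_l) (x : leaf) : (inr x == inl i :> W) = false.
Proof. by []. Qed.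

Lemma inr_eqE (x y : leaf) : (inr x == inr y :> W) = (x == y).
Proof. by []. Qed.

Definition wE := (inl_eqE, inl_inrE, inr_inlE, inr_eqE).

Lemma parent_edge_inj : injective parent_edge.
Proof.
case=> [i|x] [j|y] /setP E.
- have := E (inl i); have := E (inl j); rewrite !inE !wE !eqxx !orbT.
  move=> Hj Hi; congr inl; apply: val_inj; move: Hi Hj; rewrite -!val_eqE /=; lia.
- by have := E (inr y); rewrite !inE !wE eqxx.
- by have := E (inr x); rewrite !inE !wE eqxx.
- by have := E (inr x); rewrite !inE !wE eqxx /= => /esym/eqP->.
Qed.

Lemma caterpillar_parent_edge (hl : 0 < l) :
  caterpillar a = parent_edge @: [set~ inl (Ordinal hl)].
Proof.
apply/setP => u; apply/setUP/imsetP.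
- case=> /imsetP[].
    case=> i j; rewrite inE /= => /eqP ij ->; exists (inl j).
      by rewrite !inE wE -val_eqE /= ij.
    by rewrite /=; congr [set inl _; _]; apply: val_inj; rewrite /= ij.
  by move=> x _ ->; exists (inr x) => //; rewrite !inE.
- case=> -[t|x]; rewrite !inE ?wE => tn0 ->; [left | right]; last exact: imset_f.
  apply/imsetP; exists (Ordinal (leq_ltn_trans (leq_pred t) (ltn_ord t)), t) => //.
  by rewrite inE /=; move: tn0; rewrite -val_eqE /=; lia.
Qed.

Lemma card_caterpillar : 0 < l -> #|caterpillar a| = #|W| - 1.
Proof.
move=> hl; rewrite (caterpillar_parent_edge hl).
rewrite card_imset; last exact: parent_edge_inj.
by rewrite cardsC1 subn1.
Qed.

Lemma card_caterpillar_vertex : #|W| = l + #|{: leaf}|.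
Proof. by have := card_sum 'I_l leaf; rewrite card_ord. Qed.

Lemma caterpillar_spine u : u \in caterpillar a -> exists t, inl t \in u.
Proof.
case/setUP => /imsetP[].
  by case=> i j _ ->; exists i; rewrite !inE eqxx.
by move=> x _ ->; exists (tag x); rewrite !inE eqxx.
Qed.

Lemma leaf_edge_in (x : leaf) : [set inl (tag x); inr x] \in caterpillar a.
Proof. by apply/setUP; right; apply: imset_f. Qed.

Lemma spine_edge_in (i j : 'I_l) :
  j = i.+1 :> nat -> [set inl i; inl j] \in caterpillar a.
Proof.
move=> ij; apply/setUP; left; apply/imsetP; exists (i, j) => //.
by rewrite inE /= ij.
Qed.

End Caterpillar.

(** * Lower bound *)
Lemma bin2_sub m j : 'C(m, 2) <= 'C(m - j, 2) + j * m.-1.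
Proof.
elim: j => [|j IH]; first by rewrite subn0 mul0n addn0.
apply: leq_trans IH _; rewrite mulSn addnA leq_add2r subnS.
by case: (m - j) (leq_subr j m) => //= k km; rewrite binS bin1 leq_add2l; lia.
Qed.

(** What [j] vertices are charged when [x] are already in place, as bounded by
    [bin2_sub], against the starting edges that they bring in. *)
Lemma charge_arith b x j : 0 < j -> j * (b - x).-1 <= j * b.+1 - (x + j) - 1.
Proof.
have [bx _|xb] := leqP b x; first by rewrite (eqP bx) muln0.
have -> : b = (x + (b - x.+1)).+1 by lia.
have -> : ((x + (b - x.+1)).+1 - x).-1 = b - x.+1 by lia.
case: j => // j _; rewrite !mulnS mulnDr [_ * x]mulSn.
move: (j.+1 * _) (j * x) => p q. lia.
Qed.

Definition edges_at (V : finType) (E : {set {set V}}) (A : {set V}) :=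
  [set e in E | ~~ [disjoint e & A]].

Definition edges_off (V : finType) (E : {set {set V}}) (A : {set V}) :=
  [set e in E | [disjoint e & A]].

Section LowerBound.
Variables (l : nat) (a : 'I_l -> nat) (b : nat).
Hypothesis lt_b_a : forall t, b < a t.
Notation W := (caterpillar_vertex a).
Notation leaf := {t : 'I_l & 'I_(a t)}.
Variables (V : finType) (E0 : {set {set V}}) (S : {set V}).
Hypothesis card_S : #|S| <= l.

(** The amount ['C(b, 2) - 'C(b - #|X|, 2)] is the sum of the first [#|X|]
    terms of [b - 1, b - 2, ..]; subtraction being truncated, it stays at
    ['C(b, 2)] once [X] has [b] vertices. *)
Definition charged (E : {set {set V}}) (X : {set V}) :=
  (forall e, e \in E -> [disjoint e & S :|: X] -> e \in E0) /\
  'C(b, 2) <= 'C(b - #|X|, 2) + #|edges_at (edges_off E0 S) X|.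

Lemma card_leaves_over (T : {set 'I_l}) :
  #|T| * b.+1 <= #|[set x : leaf | tag x \in T]|.
Proof.
pose h (p : 'I_l * 'I_b.+1) : leaf :=
  Tagged (fun t => 'I_(a t)) (widen_ord (lt_b_a p.1) p.2).
rewrite -[b.+1]card_ord -cardsT -cardsX -(card_imset (f := h)).
  apply: subset_leq_card; apply/subsetP => _ /imsetP[p pT ->].
  by move: pT; rewrite !inE andbT.
move=> [t i] [t' i'] hE.
have /= tE := congr1 (fun x : leaf => tag x) hE.
have /= iE := congr1 (fun x : leaf => val (tagged x)) hE.
by rewrite tE; congr pair; apply: val_inj.
Qed.

(** Distinct leaves are counted through the edges that attach them. *)
Lemma copy_edge_inj (f : {ffun W -> V}) :
  injective f -> injective (fun x : leaf => f @: [set inl (tag x); inr x]).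
Proof.
move=> injf x y /(imset_inj injf) xy.
by have [] : inr x = inr y :> W := @parent_edge_inj _ _ (inr x) (inr y) xy.
Qed.

(** If the new edge misses [S :|: X], then [X] grows by the spine vertices of
    the new copy that lie outside [S :|: X]. *)
Lemma charged_step (E : {set {set V}}) X e f :
    charged E X -> copy_through (caterpillar a) (e |: E) e f ->
  exists X', charged (e |: E) X'.
Proof.
case=> EE0 le_b /and3P[/injectiveP injf /'forall_implyP Ff].
case/'exists_andP=> u [uF /eqP ue].
have [eSX|eSX] := boolP [disjoint e & S :|: X]; last first.
  exists X; split=> // e'; rewrite in_setU1 => /predU1P[-> eSX'|]; last exact: EE0.
  by rewrite eSX' in eSX.
pose T := [set t : 'I_l | f (inl t) \notin S :|: X].
pose Y := [set f (inl t) | t in T].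
have injl : injective (fun t : 'I_l => f (inl t)) by move=> i j /injf [].
have injr : injective (fun x : leaf => f (inr x)) by move=> i j /injf [].
have T_gt0 : 0 < #|T|.
  have [t tu] := caterpillar_spine uF; apply/card_gt0P; exists t; rewrite inE.
  have te : f (inl t) \in e by rewrite -ue; apply: imset_f.
  by apply: contraL eSX => tSX; apply/pred0Pn; exists (f (inl t)); rewrite /= te.
pose L0 := [set x : leaf | tag x \in T].
pose B := [set x in L0 | f (inr x) \in S :|: X].
(* The leaves in [B] share [S :|: X] with the spine vertices outside [T]. *)
have cardB : #|B| <= #|X| + #|T|.
  have BT : #|B| + #|~: T| <= #|S :|: X|.
    rewrite -(card_imset _ injr) -(card_imset _ injl).
    have : [disjoint [set f (inr x) | x in B] & [set f (inl x) | x in ~: T]].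
      apply/pred0P => v /=; apply/negP => /andP[/imsetP[x _ ->] /imsetP[t _ /injf]].
      by [].
    rewrite -leq_card_setU => /eqP <-; apply: subset_leq_card.
    apply/subsetP => v; case/setUP=> /imsetP[x]; rewrite !inE.
      by case/andP=> _ ? ->.
    by rewrite negbK => ? ->.
  have := cardsC T; rewrite card_ord => cT.
  have [+ _] := leq_card_setU S X; move: BT cT card_S => /=; lia.
have cardL := card_leaves_over T; rewrite -/L0 in cardL.
have cardLB : #|L0 :\: B| = #|L0| - #|B|.
  by rewrite cardsDS //; apply/subsetP => x; rewrite inE => /andP[].
pose h (x : leaf) := f @: [set inl (tag x); inr x].
have subh : edges_at (edges_off E0 S) X :|: ([set h x | x in L0 :\: B] :\ e)
              \subset edges_at (edges_off E0 S) (X :|: Y).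
  rewrite subUset; apply/andP; split; apply/subsetP => e'; rewrite !inE.
    case/andP=> -> /=; apply: contra => d; apply: disjointWr d; exact: subsetUl.
  case/andP=> ne /imsetP[x]; rewrite inE => /andP[xB xL0] e'x.
  have e'E : e' \in E.
    have := Ff _ (leaf_edge_in x); rewrite -/(h x) -e'x in_setU1.
    by rewrite (negPf ne).
  have e'SX : [disjoint e' & S :|: X].
    apply/pred0P => v /=; apply/negP => /andP[]; rewrite e'x => /imsetP[w].
    move: xB xL0; rewrite !inE => xB xT.
    by case/orP=> /eqP-> -> ; [apply/negP | apply/negP; move: xB; rewrite xT].
  rewrite (EE0 _ e'E e'SX) (disjointWr (subsetUl _ _) e'SX) /=.
  have xY : f (inl (tag x)) \in Y.
    by apply: (imset_f (fun t => f (inl t))); move: xL0; rewrite inE.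
  apply/pred0Pn; exists (f (inl (tag x))); rewrite /= in_setU xY orbT andbT.
  by rewrite e'x imset_f // set21.
exists (X :|: Y); split.
  move=> e' /setU1P[-> d|e'E d]; last first.
    by apply: EE0 e'E _; apply: disjointWr d; rewrite setUA subsetUl.
  have [t tu] := caterpillar_spine uF.
  have te : f (inl t) \in e by rewrite -ue; apply: imset_f.
  move/pred0P/(_ (f (inl t))): (d); rewrite /= te 2!in_setU.
  case/norP=> tS /norP[tX /negP[]].
  by apply: (imset_f (fun t => f (inl t))); rewrite !inE negb_or tS tX.
apply: leq_trans le_b _.
have cardX' : #|X :|: Y| <= #|X| + #|T|.
  have [+ _] := leq_card_setU X Y; move/leq_trans; apply.
  by rewrite card_imset.
have disjh : #|edges_at (edges_off E0 S) X :&: ([set h x | x in L0 :\: B] :\ e)| = 0.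
  apply: eq_card0 => e'; apply/negP; rewrite !inE.
  case/andP=> /andP[_ /pred0Pn[v /andP[ve' /= vX]]] /andP[_ /imsetP[x]].
  rewrite !inE => /andP[xB xT] e'x; move: ve'; rewrite /= e'x => /imsetP[w].
  rewrite !inE => /orP[] /eqP -> vE; rewrite {}vE in vX.
    by move: xT; rewrite vX orbT.
  by move: xB; rewrite xT vX orbT.
(* The set of leaf edges may contain [e], the only one not yet present. *)
have gain : #|edges_at (edges_off E0 S) X| + #|T| * (b - #|X|).-1
              <= #|edges_at (edges_off E0 S) (X :|: Y)|.
  apply: leq_trans (subset_leq_card subh); rewrite cardsU disjh subn0 leq_add2l.
  apply: leq_trans (charge_arith b #|X| T_gt0) _.
  have := cardsD1 e [set h x | x in L0 :\: B].
  rewrite card_imset ?cardLB; last exact: copy_edge_inj.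
  by move: cardB cardL; case: (e \in _) => /=;
    move: #|L0| #|B| #|X| #|T| #|_ :\ e| (_ * b.+1) => *; lia.
apply: leq_trans (leq_add (leqnn _) gain).
rewrite [leqRHS]addnCA [leqLHS]addnC leq_add2l.
apply: leq_trans (bin2_sub _ #|T|) _.
by rewrite leq_add2r -subnDA leq_bin2l // leq_sub2l.
Qed.

Lemma charged_process (E : {set {set V}}) X s :
    charged E X -> saturating_order (caterpillar a) E s ->
  exists X', charged (E :|: [set e in s]) X'.
Proof.
elim: s E X => [|e s IH] E X cE /=.
  by exists X; rewrite set_nil setU0.
case/andP=> /existsP[f cf] so.
have [X' cE'] := charged_step cE cf.
by have := IH _ _ cE' so; rewrite -setUA set_cons [_ |: (E :|: _)]setUCA.
Qed.

Lemma charged_start : charged E0 set0.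
Proof. by split=> //; rewrite cards0 subn0 leq_addr. Qed.

End LowerBound.

Lemma card_edges_split (V : finType) (E : {set {set V}}) (S : {set V}) :
  #|E| = #|edges_at E S| + #|edges_off E S|.
Proof.
rewrite -(cardsID [set e : {set V} | ~~ [disjoint e & S]] E); congr (_ + _);
  by apply: eq_card => e; rewrite !inE ?negbK // andbC.
Qed.

Lemma card_complete_in (V : finType) (E : {set {set V}}) (A : {set V}) :
    (forall e, e \in complete V -> e \subset A -> e \in E) ->
  'C(#|A|, 2) <= #|E|.
Proof.
move=> AE; rewrite -cards_draws; apply: subset_leq_card; apply/subsetP => e.
by rewrite inE => /andP[eA e2]; apply: AE; rewrite // inE.
Qed.

(** The size condition leaves room for a clique on [b] vertices outside
    [S :|: X] as long as [#|X| < b], and makes a complete graph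
    large enough in case no edge is ever added. *)
Lemma caterpillar_lower_bound (l : nat) (a : 'I_l -> nat) (b n : nat)
    (E : {set {set 'I_n}}) :
    0 < l -> (forall t, b < a t) -> #|caterpillar_vertex a| + 2 * b <= n ->
    weakly_saturated (caterpillar a) E ->
  #|caterpillar_vertex a| - 2 + 'C(b, 2) <= #|E|.
Proof.
move=> hl lt_b_a le_n; have cF := card_caterpillar a hl.
set K := #|caterpillar_vertex a| in le_n cF *.
have le_l : l < K.
  rewrite /K card_caterpillar_vertex -addn1 leq_add2l; apply/card_gt0P.
  have a0 : 0 < a (Ordinal hl) by apply: leq_ltn_trans (lt_b_a _).
  by exists (Tagged (fun t => 'I_(a t)) (Ordinal a0)).
case/hasP => s; rewrite mem_permutations => ps so.
have EsC e : e \in complete 'I_n -> e \in E :|: [set e in s].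
  by move=> eC; rewrite !inE (perm_mem ps) mem_enum inE eC andbT orbN.
case: s => [|e0 s] in ps so EsC *.
  have : 'C(#|[set: 'I_n]|, 2) <= #|E|.
    by apply: card_complete_in => e /EsC; rewrite !inE orbF.
  rewrite cardsT card_ord; apply: leq_trans.
  apply: leq_trans (leq_bin2l 2 le_n).
  have -> : K + 2 * b = (K.-1 + 2 * b).+1 by lia.
  by rewrite binS bin1 addnC leq_add ?leq_bin2l; lia.
have /andP[/existsP[f cf] _] := so.
case/and3P: cf => /injectiveP injf /'forall_implyP Ff _.
pose S := [set f (inl t) | t : 'I_l].
have card_S : #|S| <= l by rewrite -[leqRHS]card_ord leq_imset_card.
have at_S : K - 2 <= #|edges_at E S|.
  have imE : [set f @: (u : {set _}) | u in caterpillar a] :\ e0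
               \subset edges_at E S.
    apply/subsetP => e; rewrite inE => /andP[ne /imsetP[u uF eu]].
    have [t tu] := caterpillar_spine uF.
    have := Ff u uF; rewrite -eu => /setU1P[ee0|eE]; first by rewrite ee0 set11 in ne.
    rewrite inE eE /=.
    apply/pred0Pn; exists (f (inl t)); rewrite /= eu imset_f //=.
    by apply: (imset_f (fun t => f (inl t))).
  apply: leq_trans (subset_leq_card imE).
  have := cardsD1 e0 [set f @: (u : {set _}) | u in caterpillar a].
  rewrite card_imset ?cF; last exact: imset_inj.
  by case: (_ \in _) => /=; move: #|_| => *; lia.
have [X [XE le_X]] := charged_process lt_b_a card_S (charged_start b E S) so.
rewrite (card_edges_split E S) leq_add // leqNgt; apply/negP => off_S.
have lt_X : #|X| < b.
  rewrite ltnNge; apply/negP => /eqP bX; move: le_X off_S; rewrite bX.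
  rewrite add0n ltnNge => /leq_trans -> //; apply: subset_leq_card.
  by apply/subsetP => e; rewrite inE => /andP[].
move: off_S; rewrite ltnNge; case/negP.
apply: leq_trans (_ : 'C(#|~: (S :|: X)|, 2) <= _).
  apply: leq_bin2l; have := cardsC (S :|: X); rewrite card_ord.
  have [+ _] := leq_card_setU S X; move: lt_X card_S; rewrite -/K.
  move: #|S| #|X| #|S :|: X| #|~: _| => *; lia.
apply: card_complete_in => e eC; rewrite -disjoints_subset => eSX.
by rewrite inE XE ?EsC //= (disjointWr (subsetUl _ _) eSX).
Qed.

(** * Edges forced in a closed graph *)
Section UpperBound.
Variables (l : nat) (a : 'I_l -> nat).
Hypothesis a_gt0 : forall t, 0 < a t.
Notation W := (caterpillar_vertex a).
Notation leaf := {t : 'I_l & 'I_(a t)}.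
Variables (V : finType) (E : {set {set V}}).
Hypothesis closedE : saturation_closed (caterpillar a) E.

Local Notation adj x y := ([set x; y] \in E).

Definition first_leaf (t : 'I_l) : leaf :=
  Tagged (fun t => 'I_(a t)) (Ordinal (a_gt0 t)).

Definition leaf_pos (x : leaf) : nat := (tagged x : 'I_(a (tag x))).

Lemma leaf_eq (x x' : leaf) : tag x = tag x' -> leaf_pos x = leaf_pos x' -> x = x'.
Proof.
case: x x' => [t i] [t' i'] /= tt'; case: _ / tt' in i' *; rewrite /leaf_pos /= => ii'.
by congr existT; apply: val_inj.
Qed.

Lemma adjC x y : adj x y -> adj y x.
Proof. by rewrite setUC. Qed.

Lemma closed_leaf_edge (spine : 'I_l -> V) (leaves : leaf -> V) (x0 : leaf) :
    injective spine -> injective leaves ->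
    (forall t x, spine t <> leaves x) ->
    (forall i j : 'I_l, j = i.+1 :> nat -> adj (spine i) (spine j)) ->
    (forall x, x != x0 -> adj (spine (tag x)) (leaves x)) ->
  adj (spine (tag x0)) (leaves x0).
Proof.
move=> inj_s inj_l s_l path_s adj_l.
pose f : {ffun W -> V} :=
  [ffun w : W => match w with inl t => spine t | inr x => leaves x end].
apply: (closedE (f := f)).
  by rewrite inE cards2; have /eqP -> : spine (tag x0) <> leaves x0 by apply: s_l.
apply/and3P; split.
- apply/injectiveP => -[t|x] [t'|x']; rewrite !ffunE => ff'.
  + by rewrite (inj_s _ _ ff').
  + by case: (s_l _ _ ff').
  + by case: (s_l _ _ (esym ff')).
  + by rewrite (inj_l _ _ ff').
- apply/'forall_implyP => u /setUP[] /imsetP[].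
    case=> i j; rewrite inE /= => /eqP ij ->.
    by rewrite imsetU !imset_set1 !ffunE in_setU1 path_s ?orbT.
  move=> x _ ->; rewrite imsetU !imset_set1 !ffunE in_setU1.
  by have [-> | /adj_l ->] := eqVneq x x0; rewrite ?eqxx ?orbT.
apply/'exists_andP; exists [set inl (tag x0); inr x0]; split.
  exact: leaf_edge_in.
by rewrite imsetU !imset_set1 !ffunE.
Qed.

Lemma star_le_card t : a t <= #|{: leaf}|.
Proof.
rewrite -[a t]card_ord -(card_imset (f := fun i => Tagged (fun t => 'I_(a t)) i)).
  exact: max_card.
by move=> i j /eqP; rewrite eq_Tagged => /eqP.
Qed.

(** Only the star centred at [spine t], to which the edge belongs, has to be
    supplied with care, by [L].  The other spine vertices choose their leaves
    in the pool [Z]; removing the spine and the star at [spine t] from it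
    still leaves at least [#|W|] vertices, more than enough for all of them. *)
Lemma closed_star_edge (spine : 'I_l -> V) (t : 'I_l) (y : V) (L Z : {set V}) :
    injective spine ->
    (forall i j : 'I_l, j = i.+1 :> nat -> adj (spine i) (spine j)) ->
    (forall i, y <> spine i) ->
    (forall i, spine i \notin L) ->
    a t <= #|y |: L| -> (forall z, z \in L -> z != y -> adj (spine t) z) ->
    2 * #|W| <= #|Z| ->
    (forall i z, i != t -> z \in Z -> z != spine i -> adj (spine i) z) ->
  adj (spine t) y.
Proof.
move=> inj_s path_s y_s s_L le_L adj_L le_Z adj_Z.
(* Putting [y] first makes it the image of [first_leaf t]. *)
pose ls := y :: take (a t).-1 (enum (L :\ y)).
have size_ls : size ls = a t.
  rewrite /= size_take -cardE; move: le_L (a_gt0 t); rewrite cardsU1.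
  rewrite (cardsD1 y L); case: (y \in L) => /=; move: #|_ :\ _| => d;
    case: (ltnP _ d); lia.
have ls_L v : v \in ls -> v = y \/ v \in L /\ v != y.
  rewrite in_cons => /predU1P[->|/mem_take]; first by left.
  by rewrite mem_enum !inE => /andP[]; right.
have uniq_ls : uniq ls.
  rewrite /= take_uniq ?enum_uniq // andbT; apply/negP => /mem_take.
  by rewrite mem_enum !inE eqxx.
have card_ls : #|[set v in ls]| = a t by rewrite cardsE -size_ls; apply/card_uniqP.
pose pool := enum (Z :\: ([set v in ls] :|: [set spine i | i : 'I_l])).
have size_pool : #|{: leaf}| <= size pool.
  rewrite -cardE; move: le_Z (star_le_card t); rewrite card_caterpillar_vertex.
  have := cardsID ([set v in ls] :|: [set spine i | i : 'I_l]) Z.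
  have [+ _] := leq_card_setU [set v in ls] [set spine i | i : 'I_l].
  rewrite card_imset // card_ord card_ls.
  have := subset_leq_card (subsetIr Z ([set v in ls] :|: [set spine i | i : 'I_l])).
  move: #|{: leaf}| #|Z| #|_ :\: _| #|_ :&: _| #|_ :|: _| => *; lia.
have pool_in x : nth y pool (enum_rank x : 'I_#|{: leaf}|) \in pool.
  by apply: mem_nth; apply: leq_trans size_pool; apply: ltn_ord.
have poolP v : v \in pool -> [/\ v \in Z, v \notin ls & forall i, v != spine i].
  rewrite mem_enum !inE negb_or => /andP[/andP[vls vs] vZ]; split=> // i.
  by apply: contraNneq vs => ->; apply: imset_f.
pose leaves (x : leaf) :=
  if tag x == t then nth y ls (leaf_pos x) else nth y pool (enum_rank x).
have leaves_ls x : tag x = t -> leaf_pos x < size ls by rewrite size_ls => <-; apply: ltn_ord.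
have leavesP x : leaves x =
    if tag x == t then nth y ls (leaf_pos x) else nth y pool (enum_rank x).
  by [].
have leaves_in x : leaves x \in if tag x == t then ls else pool.
  rewrite leavesP; case: eqP => [tx|_].
    exact/mem_nth/leaves_ls.
  exact: pool_in.
have -> : y = leaves (first_leaf t) by rewrite /leaves /= eqxx.
apply: (@closed_leaf_edge spine leaves (first_leaf t)) => //.
- move=> x x'; have := leaves_in x; have := leaves_in x'.
  have [tx|ntx] := eqVneq (tag x) t; have [tx'|ntx'] := eqVneq (tag x') t.
  + move=> _ _; rewrite !leavesP tx tx' eqxx => /eqP.
    rewrite nth_uniq ?leaves_ls //.
    by move/eqP; apply: leaf_eq; rewrite tx tx'.
  + by move=> /poolP[_ + _] + xx'; rewrite xx' => /negP.
  + by move=> + /poolP[_ + _] xx'; rewrite xx' => + /negP.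
  + move=> _ _; rewrite !leavesP (negPf ntx) (negPf ntx') => /eqP.
    rewrite nth_uniq ?enum_uniq ?(leq_trans (ltn_ord _) size_pool) //.
    by move/eqP/val_inj/enum_rank_inj.
- move=> i x ix; have := leaves_in x; rewrite -ix; case: eqP => _.
    by move=> /ls_L[/esym/y_s|[]] //; rewrite (negPf (s_L i)).
  by case/poolP=> _ _ /(_ i); rewrite eqxx.
- move=> x nx; have := leaves_in x; case: eqP => [tx|/eqP ntx].
    case/ls_L => [xy|[xL xy]]; last by rewrite tx adj_L.
    case/eqP: nx; apply: leaf_eq => //; apply/eqP.
    move: xy; rewrite leavesP tx eqxx => /eqP.
    by rewrite -[y in _ == y]/(nth y ls 0) nth_uniq ?leaves_ls.
  by case/poolP=> xZ _ xs; apply: adj_Z.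
Qed.

(** * Completing a tree minus a leaf edge and a disjoint clique *)

Variables (t0 : 'I_l) (g : W -> V) (C : {set V}).
Hypothesis inj_g : injective g.
Hypothesis E_tree : forall u, u \in caterpillar a ->
  u != [set inl t0; inr (first_leaf t0)] -> g @: u \in E.
Hypothesis card_C : #|C| = (a t0).-1.
Hypothesis g_C : forall w, g w \notin C.
Hypothesis E_clique : forall x y, x \in C -> y \in C -> x != y -> adj x y.

Local Notation v t := (g (inl t)).
Let R := ~: [set g w | w : W].
Hypothesis card_R : 2 * #|W| < #|R|.

Lemma imset_set2 (w w' : W) : g @: [set w; w'] = [set g w; g w'].
Proof. by rewrite imsetU !imset_set1. Qed.

Lemma fresh_neq x w : x \in R -> x <> g w.
Proof. by rewrite inE => /negP xR xw; apply: xR; rewrite xw imset_f. Qed.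

Lemma C_fresh x : x \in C -> x \in R.
Proof.
move=> xC; rewrite inE; apply/imsetP => -[w _ xw].
by rewrite xw (negPf (g_C w)) in xC.
Qed.

Lemma spine_inj : injective (fun t : 'I_l => v t).
Proof. by move=> i j /inj_g []. Qed.

Lemma spine_path (i j : 'I_l) : j = i.+1 :> nat -> adj (v i) (v j).
Proof.
move=> ij; rewrite -imset_set2; apply: E_tree; first exact: spine_edge_in.
by apply/eqP => /setP /(_ (inr (first_leaf t0))); rewrite !inE eqxx.
Qed.

Lemma old_leaf_adj x : x != first_leaf t0 -> adj (v (tag x)) (g (inr x)).
Proof.
move=> nx; rewrite -imset_set2; apply: E_tree; first exact: leaf_edge_in.
by apply: contraNneq nx => /setP /(_ (inr x)); rewrite !inE eqxx orbT.
Qed.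

(** In the original copy, [z] replaces the missing leaf of [v t0], unless
    [s = t0], when [x] does so itself; for [s <> t0], [x] takes the
    place of the first leaf of [v s]. *)
Lemma swap_leaf s x z : x \in R -> z \in R -> z != x ->
  (s != t0 -> adj (v t0) z) -> adj (v s) x.
Proof.
move=> xR zR zx adjz.
pose leaves (p : leaf) := if p == first_leaf s then x else
  if p == first_leaf t0 then z else g (inr p).
have -> : x = leaves (first_leaf s) by rewrite /leaves eqxx.
apply: (@closed_leaf_edge (fun t => v t) leaves (first_leaf s)).
- exact: spine_inj.
- move=> p q; rewrite /leaves.
  case: eqP => [->|_]; case: eqP => [->|_] //;
    try case: eqP => [->|_]; try case: eqP => [->|_] //.
  + by move=> /esym xz; rewrite xz eqxx in zx.
  + by move/(fresh_neq xR).
  + by move=> xz; rewrite xz eqxx in zx.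
  + by move/(fresh_neq zR).
  + by move/esym/(fresh_neq xR).
  + by move/esym/(fresh_neq zR).
  + by move/inj_g => -[].
- move=> t p; rewrite /leaves; case: eqP => _; first by move/esym/(fresh_neq xR).
  case: eqP => _; first by move/esym/(fresh_neq zR).
  by move/inj_g.
- exact: spine_path.
- move=> p ps; rewrite /leaves (negPf ps); have [pt|pt] := eqVneq p (first_leaf t0).
    by rewrite pt; apply: adjz; apply: contraNneq ps => ->; rewrite pt.
  exact: old_leaf_adj.
Qed.

Lemma exists_fresh x : exists2 z, z \in R & z != x.
Proof.
have : 0 < #|R :\ x|.
  have W_gt0 : 0 < #|W| by apply/card_gt0P; exists (inl t0).
  rewrite lt0n; apply: contraTneq card_R => R0; rewrite (cardsD1 x R) R0 addn0.
  by move: W_gt0; case: (_ \in _) => /=; case: #|_| => // k _; lia.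
by case/card_gt0P => z; rewrite !inE => /andP[zx zR]; exists z; rewrite ?inE.
Qed.

(** [swap_leaf] gives this for [s = t0], and this case provides its last
    hypothesis for the other [s]. *)
Lemma spine_adj_fresh s x : x \in R -> adj (v s) x.
Proof.
have step t y : (t != t0 -> forall z, z \in R -> adj (v t0) z) -> y \in R -> adj (v t) y.
  move=> adj0 yR; have [z zR zy] := exists_fresh y.
  by apply: (swap_leaf yR zR zy) => /adj0; apply.
by move=> xR; apply: (step) => // _ z zR; apply: step => //; rewrite eqxx.
Qed.

Let S := [set v t | t : 'I_l].

Lemma notin_spine x t : x \notin S -> x <> v t.
Proof. by move=> /negP xS xt; apply: xS; rewrite xt imset_f. Qed.

Lemma fresh_notin_spine x : x \in R -> x \notin S.
Proof. by move=> xR; apply/imsetP => -[t _ /(fresh_neq xR)]. Qed.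

Lemma fresh_large t : a t <= #|R|.
Proof.
have := star_le_card t; move: card_R; rewrite card_caterpillar_vertex.
by move: #|{:leaf}| #|R|; lia.
Qed.

(** The leaves of the original copy can be released: fresh vertices now serve
    as leaves everywhere. *)
Lemma spine_adj_outside s x : x \notin S -> adj (v s) x.
Proof.
move=> xS; apply: (@closed_star_edge (fun t => v t) s x R R).
- exact: spine_inj.
- exact: spine_path.
- by move=> i; apply: notin_spine.
- by move=> i; apply/negP => /fresh_neq; apply.
- by apply: leq_trans (fresh_large s) (subset_leq_card (subsetUr _ _)).
- by move=> z zR _; apply: spine_adj_fresh.
- exact: ltnW.
- by move=> i z _ zR _; apply: spine_adj_fresh.
Qed.

(** Here [x] replaces [v t0] in the spine.  Both [y] and the displaced vertex
    [v t0] can be leaves at [x]; [L] supplies the others. *)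
Lemma outside_star x (L : {set V}) y :
    x \notin S -> y \notin S -> y != x ->
    x \notin L -> (forall z, z \in L -> z \notin S) -> (a t0).-2 <= #|L| ->
    y \notin L -> (forall z, z \in L -> adj x z) ->
  adj x y.
Proof.
move=> xS yS yx xL LS le_L yL adjL.
pose sp t := if t == t0 then x else v t.
have sp0 : sp t0 = x by rewrite /sp eqxx.
rewrite -[x]sp0; apply: (@closed_star_edge sp t0 y (v t0 |: L) R).
- move=> i j; rewrite /sp; case: eqP => [->|it]; case: eqP => [->|jt] //.
  + by move=> /(notin_spine xS).
  + by move=> /esym/(notin_spine xS).
  + exact: spine_inj.
- move=> i j ij; rewrite /sp; case: eqP => [it|_]; case: eqP => [jt|_].
  + by move: ij; rewrite it jt => /n_Sn.
  + by apply: adjC; apply: spine_adj_outside.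
  + exact: spine_adj_outside.
  + exact: spine_path.
- move=> i; rewrite /sp; case: eqP => _; first exact/eqP.
  exact: notin_spine.
- move=> i; rewrite /sp in_setU1 negb_or; case: (i =P t0) => [_|it].
    by rewrite xL andbT; apply/eqP/notin_spine.
  rewrite (inj_eq spine_inj); apply/andP; split; first exact/eqP.
  by apply/negP => /LS; rewrite imset_f.
- rewrite !cardsU1 !inE !negb_or yL; have /eqP -> : y <> v t0 by apply: notin_spine.
  have -> : v t0 \notin L by apply/negP => /LS; rewrite imset_f.
  by move: le_L; move: #|L|; lia.
- rewrite sp0 => z /setU1P[-> _|zL _]; last exact: adjL.
  by apply: adjC; apply: spine_adj_outside.
- exact: ltnW.
- move=> i z it zR _; rewrite /sp (negPf it); exact: spine_adj_fresh.
Qed.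

(** The [#|C| - 1 = a t0 - 2] other clique vertices serve as leaves of [x]. *)
Lemma clique_adj_outside x y : x \in C -> y \notin S -> y != x -> adj x y.
Proof.
move=> xC yS yx; have [yC|yC] := boolP (y \in C).
  by apply: E_clique; rewrite // eq_sym.
apply: (@outside_star x (C :\ x)) => //.
- exact/fresh_notin_spine/C_fresh.
- by rewrite !inE eqxx.
- by move=> z /setD1P[_ zC]; apply/fresh_notin_spine/C_fresh.
- by have := cardsD1 x C; rewrite xC card_C; move: #|_ :\ _|; lia.
- by rewrite !inE (negPf yC) andbF.
- by move=> z /setD1P[zx zC]; apply: E_clique; rewrite // eq_sym.
Qed.

(** Once the clique is joined to everything off the spine, it supplies the
    leaves of any other vertex. *)
Lemma outside_adj x y : x \notin S -> y \notin S -> x != y -> adj x y.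
Proof.
move=> xS yS xy.
have [xC|xC] := boolP (x \in C); first by apply: clique_adj_outside; rewrite // eq_sym.
have [yC|yC] := boolP (y \in C); first by apply: adjC; apply: clique_adj_outside.
apply: (@outside_star x C) => //.
- by rewrite eq_sym.
- by move=> z zC; apply/fresh_notin_spine/C_fresh.
- by rewrite card_C; lia.
- by move=> z zC; apply/adjC/clique_adj_outside => //; apply: contraNneq xC => ->.
Qed.

Lemma leaf_notin_spine p : g (inr p) \notin S.
Proof. by apply/imsetP => -[t _ /inj_g]. Qed.

(** Everything off the spine being joined already, a new spine can be chosen
    there except for [v s], which has [v s'] among its leaves. *)
Lemma spine_adj_spine s s' : s != s' -> adj (v s) (v s').
Proof.
move=> ss'.
pose sp t := if t == s then v s else g (inr (first_leaf t)).
have sps : sp s = v s by rewrite /sp eqxx.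
have sp_out t : t != s -> sp t \notin S by move=> /negPf ts; rewrite /sp ts leaf_notin_spine.
rewrite -sps; apply: (@closed_star_edge sp s (v s') R R).
- move=> i j; rewrite /sp; case: eqP => [->|it]; case: eqP => [->|jt] //.
  + by move/inj_g.
  + by move/inj_g.
  + by move/inj_g => [].
- move=> i j ij; have [is_|is_] := eqVneq i s; have [js|js] := eqVneq j s.
  + by move: ij; rewrite is_ js => /n_Sn.
  + by rewrite is_ sps; apply: spine_adj_outside; apply: sp_out.
  + by rewrite js sps; apply/adjC/spine_adj_outside; apply: sp_out.
  + apply: outside_adj; rewrite ?sp_out // /sp (negPf is_) (negPf js).
    apply/eqP => /inj_g [] ij'; by move: ij; rewrite ij' => /n_Sn.
- move=> i; rewrite /sp; case: eqP => _ /inj_g // -[] s's; by rewrite s's eqxx in ss'.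
- by move=> i; rewrite /sp; case: eqP => _; apply/negP => /fresh_neq; apply.
- by apply: leq_trans (fresh_large s) (subset_leq_card (subsetUr _ _)).
- by move=> z zR _; rewrite sps; apply: spine_adj_fresh.
- exact: ltnW.
- move=> i z is_ zR zsp; apply: outside_adj; rewrite ?sp_out //; last by rewrite eq_sym.
  exact: fresh_notin_spine.
Qed.

Lemma closed_complete : complete V \subset E.
Proof.
apply/subsetP => e; rewrite inE => /cards2P[x [y [xy ->]]].
have [/imsetP[s _ xs]|xS] := boolP (x \in S);
  have [/imsetP[s' _ ys]|yS] := boolP (y \in S).
- by rewrite xs ys; apply: spine_adj_spine; apply: contraNneq xy => ss'; rewrite xs ys ss'.
- by rewrite xs; apply: spine_adj_outside.
- by rewrite ys; apply/adjC/spine_adj_outside.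
- exact: outside_adj.
Qed.

End UpperBound.

(** * The limit value *)

(** Here [t0] is arbitrary: any spine vertex can be the one that loses a leaf
    and is displaced by the clique vertices. *)
Lemma caterpillar_upper_bound (l : nat) (a : 'I_l -> nat) (n : nat) (t0 : 'I_l) :
    (forall t, 0 < a t) -> 3 * #|caterpillar_vertex a| < n ->
  wsat n (caterpillar a) <= #|caterpillar_vertex a| - 2 + 'C((a t0).-1, 2).
Proof.
move=> a_gt0 lt_n; set W := caterpillar_vertex a.
have le_n : #|W| <= n by apply: leq_trans (ltnW lt_n); rewrite leq_pmull.
pose g (w : W) := widen_ord le_n (enum_rank w).
have inj_g : injective g by move=> w w' /(congr1 val) /= /val_inj /enum_rank_inj.
pose R := ~: [set g w | w : W].
have card_R : 2 * #|W| < #|R|.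
  have := cardsC [set g w | w : W]; rewrite card_imset // card_ord -/R.
  by move: lt_n; rewrite -/W; move: #|W| #|R|; lia.
have [C] : exists C, C \in [set C : {set 'I_n} | C \subset R & #|C| == (a t0).-1].
  apply/card_gt0P; rewrite cards_draws bin_gt0; move: card_R (star_le_card a t0).
  by rewrite card_caterpillar_vertex; move: #|R| #|{: {t : 'I_l & 'I_(a t)}}|; lia.
rewrite inE => /andP[CR /eqP card_C].
pose missing : {set W} := [set inl t0; inr (first_leaf a_gt0 t0)].
pose T := [set g @: (u : {set W}) | u in caterpillar a :\ missing].
pose Q := [set e : {set 'I_n} | e \subset C & #|e| == 2].
have simpleTQ : T :|: Q \subset complete 'I_n.
  rewrite subUset; apply/andP; split; apply/subsetP => e.
    case/imsetP => u /setD1P[_ /(subsetP (caterpillar_simple a))] + ->.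
    by rewrite !inE card_imset.
  by rewrite !inE => /andP[].
apply: leq_trans (wsat_le simpleTQ _) _.
- apply: (weakly_saturated_closed simpleTQ) => E /subUsetP[TE QE] _ closedE.
  apply: (@closed_complete _ _ a_gt0 _ _ closedE t0 g C) => //.
  + by move=> u uF nu; apply/(subsetP TE)/imset_f/setD1P.
  + move=> w; apply/negP => /(subsetP CR); rewrite inE => /negP; apply.
    exact: imset_f.
  + move=> x y xC yC xy; apply: (subsetP QE); rewrite inE cards2 xy andbT.
    by rewrite subUset !sub1set xC.
- have [+ _] := leq_card_setU T Q; move/leq_trans; apply.
  apply: leq_add; last by rewrite cards_draws card_C.
  apply: leq_trans (leq_imset_card _ _) _.
  have := cardsD1 missing (caterpillar a).
  rewrite (leaf_edge_in (first_leaf a_gt0 t0)) card_caterpillar.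
    by move: #|W| #|_|; lia.
  by apply: leq_ltn_trans (ltn_ord t0).
Qed.

Theorem theorem1p3 (l : nat) (hl : 0 < l) (a : 'I_l -> nat)
    (ha : forall t : 'I_l, 0 < a t) :
  let K := #|caterpillar_vertex a| in
  let amin := a [arg min_(t < Ordinal hl) a t] in
  wsat_limit (caterpillar a) (K - 2 + 'C(amin - 1, 2)).
Proof.
move=> K amin; set t0 := [arg min_(t < Ordinal hl) a t] in amin *.
have min_t0 t : a t0 <= a t by rewrite /t0; case: arg_minnP => // i _; apply.
exists (3 * K).+1 => n lt_n; apply/eqP; rewrite eqn_leq; apply/andP; split.
  by rewrite subn1; apply: caterpillar_upper_bound.
apply: wsat_ge => E _; apply: caterpillar_lower_bound => //.
  by move=> t; rewrite subn1 prednK // /amin.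
move: lt_n (star_le_card a t0); rewrite /K /amin card_caterpillar_vertex.
by move: #|_|; lia.
Qed.
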